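(* Let $v_0\ge 1$ be an integer and let $f=1+\sum_{v\ge v_0}p_vx^v\in K[[x]]$ with $p_{v_0}=1$. Define the coefficients $\mathfrak p_{uv}^w\in K$ ($u,v,w\in\mathbb N_0$) as follows. Put $g=\dfrac{f\,(f^{v_0}-1)}{f'}\in K[[x]]$. Let $G=\sum_{v\ge 0}g_v(x)y^v\in K[[x]][[y]]$ be the unique series with $g_0=x$ satisfying $$G_y(x,y)=g(x)f'(y)G_x(x,y)-\bigl(f(y)-1\bigr)G_y(x,y).$$ Set $\mathfrak p_{uv}^0=\delta_{0,u+v}$, let $\mathfrak p_{uv}^1$ be the coefficient of $x^uy^v$ in $G$, and for $w>1$ set recursively $\mathfrak p_{uv}^w=\sum_{u_1+u_2=u,\ v_1+v_2=v}\mathfrak p_{u_1v_1}^1\mathfrak p_{u_2v_2}^{w-1}$. Then for all $i,j,k\in\mathbb N_0$, $$\sum_{a+b=j}\sum_{h=0}^i\sum_{l=0}^k \mathfrak p_{ia}^h\mathfrak p_{kb}^l\mathfrak p_{hl}^1=\sum_{c+d=k}\sum_{h=0}^i\sum_{l=0}^j \mathfrak p_{ic}^h\mathfrak p_{jd}^l\mathfrak p_{hl}^1,$$ where the sums over $a+b=j$ and $c+d=k$ run over pairs of nonnegative integers.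
   Context: $K$ is an algebraically closed field of characteristic $0$. $K[[x]]$ and $K[[x]][[y]]=K[[x,y]]$ are formal power series rings; $f'$ is the formal derivative of $f$, and $G_x,G_y$ are the formal partial derivatives of $G$. Since $f'$ has order $v_0-1$ and $f(f^{v_0}-1)$ has order $v_0$, $g$ is a well-defined power series lying in $x+x^2K[[x]]$; comparing coefficients of $y^v$ in the displayed differential equation determines the $g_v$ recursively from $g_0=x$, so $G$ is well defined. *)

(* Defs.v *)
From HB Require Import structures.
From mathcomp Require Import all_boot all_order all_algebra.
Set Implicit Arguments. Unset Strict Implicit. Unset Printing Implicit Defensive.
Import Order.TTheory GRing.Theory Num.Theory.
Local Open Scope ring_scope.

(* Formal power series in one variable over K, represented by coefficient
   sequences: a n = coefficient of x^n. *)
Definition ps (K : Type) := nat -> K.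

Section PS.
Variable K : comRingType.

Definition psone : ps K := fun n => (n == 0%N)%:R.
Definition psX : ps K := fun n => (n == 1%N)%:R.
Definition psadd (a b : ps K) : ps K := fun n => a n + b n.
Definition pssub (a b : ps K) : ps K := fun n => a n - b n.
Definition psmul (a b : ps K) : ps K :=
  fun n => \sum_(i < n.+1) a i * b (n - i)%N.
Definition psexp (a : ps K) (m : nat) : ps K := iter m (psmul a) psone.
Definition psderiv (a : ps K) : ps K := fun n => a n.+1 *+ n.+1.

(* Formal power series in two variables x, y: A u v = coefficient of x^u y^v
   (this is K[[x]][[y]] = K[[x,y]]). *)
Definition bps := nat -> nat -> K.
Definition bpsone : bps := fun u v => ((u + v)%N == 0%N)%:R.
Definition bpssub (A B : bps) : bps := fun u v => A u v - B u v.
Definition bpsmul (A B : bps) : bps :=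
  fun u v => \sum_(i < u.+1) \sum_(j < v.+1) A i j * B (u - i)%N (v - j)%N.
Definition xser (a : ps K) : bps := fun u v => if v == 0%N then a u else 0.
Definition yser (a : ps K) : bps := fun u v => if u == 0%N then a v else 0.
Definition bpsdx (A : bps) : bps := fun u v => A u.+1 v *+ u.+1.
Definition bpsdy (A : bps) : bps := fun u v => A u v.+1 *+ v.+1.

Fixpoint frakp (G : bps) (w : nat) : bps :=
  match w with
  | 0 => bpsone
  | 1 => G
  | w'.+1 => bpsmul G (frakp G w')
  end.
End PS.

(* Main.v *)
Require Import Defs.
From HB Require Import structures.
From mathcomp Require Import all_boot all_order all_algebra.
From mathcomp Require Import boolp ring.
Import Order.TTheory GRing.Theory Num.Theory.
Local Open Scope ring_scope.

(** The two sides are the coefficients of x^i y^j z^k in G(G(x,y), G(z,y)) and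
    in G(G(x,z), G(y,z)). Put F = f^v0 and q = 1/F - 1, so that g q' = v0 q and
    f F' = v0 f' F. Hence q(x) F(y) solves the linear differential equation that
    defines G; so does q(G(x,y)), because the equation says that a derivation
    kills G. Both agree at y = 0, so q(G(x,y)) = q(x) F(y) = q(x)/(1 + q(y)).
    Consequently q(G(G(x,y), G(z,y))) = q(x)/(1 + q(y) + q(z)) is symmetric in
    y and z. As q has order v0 and G = x * unit, cancelling x^v0 from q allows
    to conclude that the arguments of q agree. Substitution of series takes
    place in a ring where x^N = y^N = z^N = 0, so that all sums are finite. *)

Set Implicit Arguments.
Unset Strict Implicit.
Unset Printing Implicit Defensive.

(** * The commutative ring of formal power series *)

HB.instance Definition _ (K : Type) := gen_eqMixin (ps K).
HB.instance Definition _ (K : Type) := gen_choiceMixin (ps K).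

Section SeriesRing.
Variable R : comNzRingType.
Implicit Types a b c : ps R.

Definition psopp a : ps R := fun n => - a n.
Definition pszero : ps R := fun=> 0.

Lemma psaddA : associative (@psadd R).
Proof. by move=> a b c; apply/funext => n; apply: addrA. Qed.

Lemma psaddC : commutative (@psadd R).
Proof. by move=> a b; apply/funext => n; apply: addrC. Qed.

Lemma psadd0 : left_id pszero (@psadd R).
Proof. by move=> a; apply/funext => n; apply: add0r. Qed.

Lemma psaddN : left_inverse pszero psopp (@psadd R).
Proof. by move=> a; apply/funext => n; apply: addNr. Qed.

HB.instance Definition _ :=
  GRing.isZmodule.Build (ps R) psaddA psaddC psadd0 psaddN.

Definition pstrunc n a : {poly R} := \poly_(i < n) a i.

(** Low coefficients of a product see only truncations, so the ring laws and the Leibniz rule are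
    inherited from polynomials. *)
Lemma coef_pstrunc_mul n a b k :
  (k < n)%N -> (pstrunc n a * pstrunc n b)`_k = psmul a b k.
Proof.
move=> ltkn; rewrite coefM; apply: eq_bigr => i _; rewrite !coef_poly.
have leik : (i <= k)%N by rewrite -ltnS.
by rewrite (leq_ltn_trans leik) // (leq_ltn_trans (leq_subr _ _)).
Qed.

Lemma psmulC : commutative (@psmul R).
Proof.
move=> a b; apply/funext => n.
by rewrite -!(@coef_pstrunc_mul n.+1) // mulrC.
Qed.

Lemma psmulA : associative (@psmul R).
Proof.
have E a b c n : psmul a (psmul b c) n =
    (pstrunc n.+1 a * (pstrunc n.+1 b * pstrunc n.+1 c))`_n.
  rewrite coefM; apply: eq_bigr => i _.
  by rewrite coef_pstrunc_mul ?ltnS ?leq_subr // coef_poly ltn_ord.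
move=> a b c; apply/funext => n.
by rewrite [RHS](congr1 (@^~ n) (psmulC _ c)) !E mulrA (mulrC (pstrunc _ c)).
Qed.

Lemma psmul1 : left_id (@psone R) (@psmul R).
Proof.
move=> a; apply/funext => n; rewrite /psmul big_ord_recl subn0 mul1r.
by rewrite big1 ?addr0 // => i _; rewrite mul0r.
Qed.

Lemma psmulD : left_distributive (@psmul R) +%R.
Proof.
move=> a b c; apply/funext => n.
rewrite -[RHS]/(psmul a c n + psmul b c n) /psmul -big_split.
by apply: eq_bigr => i _; apply: mulrDl.
Qed.

Lemma psone_neq0 : @psone R != 0.
Proof.
by apply/eqP => /(congr1 (@^~ 0%N)) /eqP; rewrite (negbTE (oner_neq0 R)).
Qed.

HB.instance Definition _ := GRing.Zmodule_isComNzRing.Build (ps R)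
  psmulA psmulC psmul1 psmulD psone_neq0.

Lemma ps1E n : (1 : ps R) n = (n == 0%N)%:R. Proof. by []. Qed.
Lemma psDE a b n : (a + b) n = a n + b n. Proof. by []. Qed.
Lemma psNE a n : (- a) n = - a n. Proof. by []. Qed.
Lemma psBE a b n : (a - b) n = a n - b n. Proof. by []. Qed.
Lemma psME a b n : (a * b) n = \sum_(i < n.+1) a i * b (n - i)%N.
Proof. by []. Qed.

Lemma psM0E a b : (a * b) 0%N = a 0%N * b 0%N.
Proof. by rewrite psME big_ord1. Qed.

Lemma psX0E a n : (a ^+ n) 0%N = a 0%N ^+ n.
Proof. by elim: n => // n IH; rewrite !exprS psM0E IH. Qed.

Lemma psMnE a m n : (a *+ m) n = a n *+ m.
Proof. by elim: m => // m IH; rewrite !mulrS psDE IH. Qed.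

Lemma ps_sumE I (r : seq I) (P : pred I) (F : I -> ps R) n :
  (\sum_(i <- r | P i) F i) n = \sum_(i <- r | P i) F i n.
Proof. exact: (big_morph (fun a : ps R => a n) (fun a b => psDE a b n)). Qed.

Lemma psexpE a n : psexp a n = a ^+ n.
Proof. by elim: n => // n IH; rewrite exprS -IH. Qed.

Lemma psX_mulS a n : (psX R * a) n.+1 = a n.
Proof.
rewrite psME big_ord_recl mul0r add0r big_ord_recl /= /bump /= subSS subn0.
by rewrite mul1r big1 ?addr0 // => i _; rewrite mul0r.
Qed.

Lemma psX_mul0 a : (psX R * a) 0%N = 0.
Proof. by rewrite psM0E mul0r. Qed.

Lemma psX_exp_mul m a n :
  (psX R ^+ m * a) n = if (m <= n)%N then a (n - m)%N else 0.
Proof.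
elim: m n => [|m IH] n; first by rewrite expr0 mul1r subn0.
rewrite exprS -mulrA; case: n => [|n]; first by rewrite psX_mul0.
by rewrite psX_mulS IH.
Qed.

Lemma psX_exp m n : (psX R ^+ m) n = (n == m)%:R.
Proof.
rewrite -[_ ^+ m]mulr1 psX_exp_mul ps1E.
by case: ltngtP => // [lt|->]; rewrite ?subnn // subn_eq0 leqNgt lt.
Qed.

Definition psshift m a : ps R := fun n => a (m + n)%N.

Lemma psX_dvd m a :
  (forall n, (n < m)%N -> a n = 0) -> a = psX R ^+ m * psshift m a.
Proof.
move=> a0; apply/funext => n; rewrite psX_exp_mul /psshift.
case: leqP => [/subnKC -> //|].
exact: a0.
Qed.

Lemma psderivD a b : psderiv (a + b) = psderiv a + psderiv b.
Proof. by apply/funext => n; rewrite /psderiv !psDE mulrnDl. Qed.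

Lemma psderivM a b : psderiv (a * b) = psderiv a * b + a * psderiv b.
Proof.
apply/funext => n; rewrite psDE /psderiv.
rewrite -[(a * b) n.+1](@coef_pstrunc_mul n.+2) //.
rewrite -coef_deriv derivM coefD !coefM; congr (_ + _); apply: eq_bigr => i _.
  rewrite coef_deriv !coef_poly ltnS ltn_ord.
  by rewrite (leq_ltn_trans (leq_subr i n)).
rewrite coef_deriv !coef_poly (ltn_trans (ltn_ord i)) //.
by rewrite ltnS (leq_ltn_trans (leq_subr i n)).
Qed.

Lemma psderivX a m : psderiv (a ^+ m.+1) = a ^+ m * psderiv a *+ m.+1.
Proof.
elim: m => [|m IH]; first by rewrite expr0 mul1r.
by rewrite exprS psderivM IH mulrnAr mulrA -exprS [RHS]mulrS mulrC.
Qed.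

(** The inverse is the geometric series in m = 1 - a. As x divides m, the power m^k has order at
    least k, and the coefficient of x^n needs only the terms k <= n. *)
Lemma ps_inv a : a 0%N = 1 -> exists b, a * b = 1.
Proof.
move=> a0; pose m := 1 - a.
have mE : m = psX R * psshift 1 m.
  rewrite -[psX R]expr1; apply: psX_dvd => -[] // _.
  by rewrite /m psBE a0 subrr.
have m_small k n : (n < k)%N -> (m ^+ k) n = 0.
  by move=> lt; rewrite mE exprMn psX_exp_mul leqNgt lt.
exists (fun n => \sum_(k < n.+1) (m ^+ k) n); apply/funext => n.
(* Up to x^n the series may be replaced by one finite sum, whose product with a telescopes to 1 -
   m^(n+1). *)
have -> : (a * (fun n => \sum_(k < n.+1) (m ^+ k) n)) n
          = (a * \sum_(k < n.+1) m ^+ k) n.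
  rewrite !psME; apply: eq_bigr => i _; congr (_ * _); rewrite ps_sumE.
  rewrite (@big_ord_widen _ _ _ _ n.+1 (fun k => (m ^+ k) (n - i)%N));
    last by rewrite ltnS leq_subr.
  rewrite big_mkcond; apply: eq_bigr => k _; case: ltnP => //= lt.
  by rewrite m_small.
have -> : a = - (m - 1) by rewrite /m; ring.
by rewrite mulNr -subrX1 opprB psBE m_small ?subr0.
Qed.

End SeriesRing.

Section Constants.
Variable R : comNzRingType.
Implicit Types (c : R) (a : ps R).

Definition pscst c : ps R := fun n => if n == 0%N then c else 0.

Lemma pscst_mul c a n : (pscst c * a) n = c * a n.
Proof.
rewrite psME big_ord_recl subn0 big1 ?addr0 // => i _.
by rewrite /pscst /= mul0r.
Qed.

Lemma pscstM c d : pscst (c * d) = pscst c * pscst d.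
Proof.
apply/funext => n; rewrite pscst_mul /pscst.
by case: eqP => //; rewrite mulr0.
Qed.

Lemma pscst_deriv c : psderiv (pscst c) = 0.
Proof. by apply/funext => n; rewrite /psderiv /pscst /= mul0rn. Qed.

Lemma pscstMn c n : pscst (c *+ n) = pscst c *+ n.
Proof.
apply/funext => u; rewrite psMnE /pscst.
by case: eqP => // _; rewrite mul0rn.
Qed.

End Constants.

(** * Two variables and the differential equation *)

(* In [ps (ps K)] the outer exponent is that of x, as in [bps K]: constant
   series [pscst a] are series in y alone, and [inx a] is a series in x. *)
Section Bivariate.
Variable K : comNzRingType.
Implicit Types (a b : ps K) (A B : ps (ps K)).

Lemma bpsmulE A B : bpsmul A B = A * B.
Proof.
by apply/funext => u; apply/funext => v; rewrite psME ps_sumE.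
Qed.

Lemma frakpE A n : frakp A n = A ^+ n.
Proof.
have one : bpsone K = (1 : ps (ps K)).
  apply/funext => u; apply/funext => v.
  by rewrite /bpsone ps1E addn_eq0; case: eqP.
elim: n => [|[|n] IH]; first exact: one.
  by rewrite expr1.
by rewrite exprS -IH -bpsmulE.
Qed.

Lemma yserE a : yser a = pscst a.
Proof.
by apply/funext => u; apply/funext => v; rewrite /yser /pscst; case: eqP.
Qed.

Lemma bpsdxE A : bpsdx A = psderiv A.
Proof. by apply/funext => u; apply/funext => v; rewrite /psderiv psMnE. Qed.

Definition inx a : ps (ps K) := fun u => pscst (a u).
Definition dery A : ps (ps K) := fun u => psderiv (A u).

Lemma inx_mul a A u v : (inx a * A) u v = \sum_(i < u.+1) a i * A (u - i)%N v.
Proof.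
by rewrite psME ps_sumE; apply: eq_bigr => i _; apply: pscst_mul.
Qed.

Lemma inxM a b : inx (a * b) = inx a * inx b.
Proof.
apply/funext => u; apply/funext => v; rewrite inx_mul /inx /pscst psME.
by case: eqP => // _; rewrite big1 // => i _; apply: mulr0.
Qed.

Lemma inxMn a n : inx (a *+ n) = inx a *+ n.
Proof. by apply/funext => u; rewrite psMnE /inx psMnE pscstMn. Qed.

Lemma inxX a n : inx (a ^+ n) = inx a ^+ n.
Proof.
elim: n => [|n IH]; last by rewrite !exprS inxM IH.
apply/funext => u; apply/funext => v; rewrite /inx /pscst !expr0 !ps1E.
by case: v => [|v]; case: u.
Qed.

Lemma inx_psX : inx (psX K) = psX (ps K).
Proof.
apply/funext => u; apply/funext => v; rewrite /inx /psX /pscst.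
by case: v => [|v]; case: u => [|[]].
Qed.

Lemma inx0 : inx 0 = 0.
Proof.
by apply/funext => u; apply/funext => v; rewrite /inx /pscst if_same.
Qed.

Lemma derx_inx a : psderiv (inx a) = inx (psderiv a).
Proof.
apply/funext => u; apply/funext => v; rewrite /inx /psderiv psMnE /pscst.
by case: eqP => // _; rewrite mul0rn.
Qed.

Lemma dery_inx a : dery (inx a) = 0.
Proof. by apply/funext => u; apply: pscst_deriv. Qed.

Lemma dery_cst a : dery (pscst a) = pscst (psderiv a).
Proof.
apply/funext => u; rewrite /dery /pscst; case: eqP => // _.
by apply/funext => v; apply: mul0rn.
Qed.

Lemma deryD A B : dery (A + B) = dery A + dery B.
Proof. by apply/funext => u; apply: psderivD. Qed.

Lemma deryM A B : dery (A * B) = dery A * B + A * dery B.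
Proof.
apply/funext => u; rewrite psDE !psME -big_split /dery psME.
rewrite (big_morph _ (@psderivD K) (_ : psderiv 0 = 0)).
  by apply: eq_bigr => i _; apply: psderivM.
by apply/funext => n; apply: mul0rn.
Qed.

(** With (f(y) - 1) G_y moved to the left, the equation of G reads D G = 0 for the derivation D =
    f(y) d/dy - g(x) f'(y) d/dx. Hence D also kills polynomials in G with constant coefficients. *)
Definition pdeop (f g : ps K) A : ps (ps K) :=
  pscst f * dery A - inx g * pscst (psderiv f) * psderiv A.

Lemma pdeopD f g A B : pdeop f g (A + B) = pdeop f g A + pdeop f g B.
Proof. by rewrite /pdeop deryD psderivD; ring. Qed.

Lemma pdeopM f g A B : pdeop f g (A * B) = pdeop f g A * B + A * pdeop f g B.
Proof. by rewrite /pdeop deryM psderivM; ring. Qed.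

Lemma pdeopX f g A n : pdeop f g A = 0 -> pdeop f g (A ^+ n) = 0.
Proof.
move=> DA; elim: n => [|n IH]; last first.
  by rewrite exprS pdeopM DA IH mul0r mulr0 addr0.
(* D(1) = D(1 * 1) = D(1) + D(1) forces D(1) = 0. *)
rewrite expr0; apply: (addrI (pdeop f g 1)).
by rewrite addr0 -{3}(mulr1 1) pdeopM mulr1 mul1r.
Qed.

Lemma pdeop_scal f g (c : K) A :
  pdeop f g (inx (pscst c) * A) = inx (pscst c) * pdeop f g A.
Proof.
rewrite pdeopM {1}/pdeop derx_inx dery_inx pscst_deriv.
by rewrite inx0 !mulr0 subrr mul0r add0r.
Qed.

Definition aty0 A : ps K := fun u => A u 0%N.

Lemma aty0M A B : aty0 (A * B) = aty0 A * aty0 B.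
Proof.
apply/funext => u; rewrite /aty0 !psME ps_sumE.
by apply: eq_bigr => i _; apply: psM0E.
Qed.

Lemma aty0X A n : aty0 (A ^+ n) = aty0 A ^+ n.
Proof.
elim: n => [|n IH]; last by rewrite !exprS aty0M IH.
by apply/funext => u; rewrite /aty0 !expr0 !ps1E; case: eqP.
Qed.

(* As x divides g, the equation makes sense modulo x^m. *)
Lemma pdeop_uniq f g A m :
  (forall (a : K) n, a *+ n.+1 = 0 -> a = 0) ->
  f 0%N = 1 -> g 0%N = 0 -> pdeop f g A = 0 ->
  (forall u, (u < m)%N -> A u 0%N = 0) ->
  forall u v, (u < m)%N -> A u v = 0.
Proof.
move=> char0 f0 g0 /eqP; rewrite subr_eq0 => /eqP DA A0 u v.
elim/ltn_ind: v u => -[|v] IH u ltum; first exact: A0.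
have := congr1 (fun B : ps (ps K) => B u v) DA.
rewrite /= pscst_mul -mulrA inx_mul.
(* The x-derivative raises the x-exponent by one, but g(0) = 0 kills the term i = 0. The other terms
   have x-exponent at most u and y-exponent at most v, so induction applies. *)
rewrite [X in _ = X]big1 => [|i _]; last first.
  case: i => -[|i] /= ltiu; first by rewrite g0 mul0r.
  rewrite pscst_mul psME big1 ?mulr0 // => j _.
  rewrite /psderiv ?psMnE IH ?mul0rn ?mulr0 // ?ltnS ?leq_subr //.
  by rewrite -subSn // subSS (leq_ltn_trans (leq_subr _ _)).
(* On the left only the constant term of f meets the unknown coefficient of y^(v+1), and it is
   multiplied by v + 1. *)
rewrite psME big_ord_recl f0 mul1r subn0 big1 ?addr0 => [|j _].
  exact: char0.
rewrite /dery /psderiv IH ?mul0rn ?mulr0 //.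
by rewrite lift0 ltnS -subSn ?subSS ?leq_subr.
Qed.

End Bivariate.

(** * The closed form of q(G) *)

Section KeyIdentity.
Variables (K : fieldType) (v0 : nat) (f g : ps K) (G : ps (ps K)).
Hypothesis char0 : [pchar K] =i pred0.
Hypothesis v0_gt0 : (0 < v0)%N.
Hypothesis f0 : f 0%N = 1.
Hypothesis f_gap : forall v, (0 < v < v0)%N -> f v = 0.
Hypothesis f_v0 : f v0 = 1.
Hypothesis gE : g * psderiv f = f * (f ^+ v0 - 1).
Hypothesis G_y0 : forall u, G u 0%N = psX K u.
Hypothesis G_pde : pdeop f g G = 0.

Lemma mulrSn_eq0 (a : K) n : a *+ n.+1 = 0 -> a = 0.
Proof.
move/pcharf0P: char0 => nat_eq0 /eqP.
by rewrite -mulr_natr mulf_eq0 nat_eq0 orbF => /eqP.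
Qed.

(** Factor f^v0 - 1 as (f - 1) times the sum of the f^i with i < v0: the first factor is x^v0 + ...,
    and each of the v0 summands has constant term 1. *)
Lemma f_powB1 : exists2 e : ps K,
  f ^+ v0 - 1 = psX K ^+ v0 * e & e 0%N = v0%:R.
Proof.
have fB1 n : (n < v0)%N -> (f - 1) n = 0.
  rewrite psBE ps1E; case: n => [|n] lt; first by rewrite f0 subrr.
  by rewrite f_gap ?subr0.
exists (psshift v0 (f - 1) * \sum_(i < v0) f ^+ i).
  by rewrite subrX1 {1}(psX_dvd fB1) mulrA.
rewrite psM0E /psshift addn0 psBE ps1E f_v0 eqn0Ngt v0_gt0 subr0 mul1r ps_sumE.
rewrite (eq_bigr (fun=> 1)) ?sumr_const ?card_ord // => i _.
by rewrite psX0E f0 expr1n.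
Qed.

(** Compare coefficients of x^(v0-1) in g f' = f (f^v0 - 1): the left gives v0 g(0), while the right
    has order at least v0. *)
Lemma g_at0 : g 0%N = 0.
Proof.
have [e powE _] := f_powB1.
have := congr1 (fun a : ps K => a v0.-1) gE.
rewrite /= powE mulrCA psX_exp_mul leqNgt prednK // leqnn /=.
rewrite psME big_ord_recl big1 => [|i _]; last first.
  rewrite /psderiv f_gap ?mul0rn ?mulr0 //= -ltn_predRL ltn_subrL.
  exact: leq_ltn_trans (leq0n i) (ltn_ord i).
rewrite addr0 subn0 /psderiv /= prednK // f_v0 mulrnAr mulr1.
case: v0 v0_gt0 => // n _; exact: mulrSn_eq0.
Qed.

(* Gam^v0 * q(G) = q(x) * F(y), for the present q with 1/F = 1 + x^v0 * q;
   since x divides G, terms with n >= N of q(G) do not matter modulo x^N. *)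
Lemma series_G_eq : exists (q : ps K) (Gam : ps (ps K)),
  [/\ q 0%N = - v0%:R, Gam 0%N 0%N = 1, G = psX (ps K) * Gam,
      (1 + psX K ^+ v0 * q) * f ^+ v0 = 1 &
      forall N u v, (u < N)%N ->
        (Gam ^+ v0 * \sum_(n < N) inx (pscst (q n)) * G ^+ n) u v
        = (inx q * pscst (f ^+ v0)) u v].
Proof.
have [e powE e0] := f_powB1.
have F0 : (f ^+ v0) 0%N = 1 by rewrite psX0E f0 expr1n.
have [b Fb] := ps_inv F0.
have fF : f * f ^+ v0.-1 = f ^+ v0 by rewrite -exprS prednK.
have F' : psderiv (f ^+ v0) = f ^+ v0.-1 * psderiv f *+ v0.
  by case: v0 v0_gt0 => // n _; apply: psderivX.
have b0 : b 0%N = 1.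
  by have := congr1 (fun a : ps K => a 0%N) Fb; rewrite psM0E F0 mul1r.
(* Uniqueness modulo x, with G(x,0) = x, shows that x divides G. *)
have G00 u v : (u < 1)%N -> G u v = 0.
  apply: (pdeop_uniq (m := 1) (@mulrSn_eq0) f0 g_at0 G_pde) => -[] //.
have GE : G = psX (ps K) * psshift 1 G.
  rewrite -[psX _]expr1; apply: psX_dvd => u ltu1.
  by apply/funext => v; apply: G00.
set Gam := psshift 1 G in GE.
(* Since e = (F - 1) / x^v0 and b = 1/F, this makes Q = 1/F - 1. *)
pose q : ps K := - (e * b); pose Q := psX K ^+ v0 * q.
have QE : Q = b - 1.
  by rewrite /Q /q mulrN mulrA -powE mulrBl Fb mul1r opprB.
exists q, Gam; split => //.
- by rewrite /q psNE psM0E e0 b0 mulr1.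
- by rewrite /Gam /psshift G_y0.
- by rewrite -/Q QE addrC subrK mulrC.
(* Differentiate F b = 1, prove the equation multiplied by F, then cancel F by means of b. *)
have gQ' : g * psderiv Q = Q *+ v0.
  have Q' : psderiv Q = psderiv b.
    apply/funext => n; rewrite QE /psderiv psBE ps1E.
    by rewrite subr0.
  have dFb : psderiv (f ^+ v0) * b + f ^+ v0 * psderiv b = 0.
    rewrite -psderivM Fb; apply/funext => n; exact: mul0rn.
  have : f ^+ v0 * (g * psderiv b) = f ^+ v0 * (Q *+ v0).
    have -> : f ^+ v0 * (g * psderiv b) = - (g * (psderiv (f ^+ v0) * b)).
      by move/eqP: dFb; rewrite addrC addr_eq0 mulrCA => /eqP ->; rewrite mulrN.
    rewrite F' (_ : g * _ = g * psderiv f * (f ^+ v0.-1 * b) *+ v0);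
      last by ring.
    rewrite gE (_ : _ * (_ * b) = f ^+ v0 * (f ^+ v0 * b - b)).
      by rewrite Fb QE; ring.
    by rewrite -fF; ring.
  move/(congr1 ( *%R b)); rewrite !mulrA [b * _]mulrC Fb !mul1r Q'.
  by [].
(* The two parts of D cancel because f F' = v0 f' F and g Q' = v0 Q. *)
have DQ : pdeop f g (inx Q * pscst (f ^+ v0)) = 0.
  rewrite pdeopM /pdeop dery_inx derx_inx dery_cst pscst_deriv.
  rewrite !mulr0 sub0r subr0.
  rewrite F' (_ : _ * inx (psderiv Q) =
      inx (g * psderiv Q) * pscst (psderiv f)).
    by rewrite gQ' inxMn pscstMn -fF !pscstM; ring.
  by rewrite inxM; ring.
move=> N u v ltuN.
(* Q(G) is needed modulo x^(v0+N), since x^v0 will be cancelled. *)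
pose H := \sum_(n < v0 + N) inx (pscst (Q n)) * G ^+ n.
have DH : pdeop f g H = 0.
  apply: (big_ind (fun A => pdeop f g A = 0)) => [|A B DA DB|n _].
  - by apply: (addrI (pdeop f g 0)); rewrite -pdeopD !addr0.
  - by rewrite pdeopD DA DB addr0.
  - by rewrite pdeop_scal pdeopX ?mulr0.
have DU : pdeop f g (H - inx Q * pscst (f ^+ v0)) = 0.
  have := DH; rewrite -{1}(subrK (inx Q * pscst (f ^+ v0)) H).
  by rewrite pdeopD DQ addr0.
(* At y = 0, G becomes x and F becomes 1, so both terms reduce to Q up to the precision of [H]. *)
have U0 w : (w < v0 + N)%N -> (H - inx Q * pscst (f ^+ v0)) w 0%N = 0.
  move=> ltw; rewrite !psBE /H !ps_sumE.
  rewrite [X in _ - X](_ : _ = Q w); last first.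
    rewrite inx_mul (bigD1 (Ordinal (ltnSn w))) //= subnn.
    rewrite -[pscst _ 0%N]/(f ^+ v0) F0 mulr1.
    rewrite big1 ?addr0 // => i /negbTE ne; rewrite /pscst subn_eq0.
    rewrite leqNgt ltn_neqAle -ltnS ltn_ord andbT.
    by rewrite -val_eqE /= in ne; rewrite ne /= mulr0.
  have GX n : (G ^+ n) w 0%N = (w == n)%:R.
    rewrite -psX_exp -[LHS]/(aty0 (G ^+ n) w) aty0X.
    by rewrite (_ : aty0 G = psX K) //; apply/funext => z; apply: G_y0.
  rewrite (eq_bigr (fun n : 'I_(v0 + N) => Q n * (w == n)%:R)) => [|n _];
    last first.
    rewrite inx_mul big_ord_recl subn0 GX big1 ?addr0 // => i _.
    by rewrite /pscst /= mul0r.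
  rewrite (bigD1 (Ordinal ltw)) //= eqxx mulr1 big1 ?addr0 ?subrr // => n ne.
  by rewrite eq_sym -val_eqE /= in ne; rewrite (negbTE ne) mulr0.
have := pdeop_uniq (@mulrSn_eq0) f0 g_at0 DU U0 (u := v0 + u) v.
rewrite ltn_add2l => /(_ ltuN).
(* The first v0 terms vanish because x^v0 divides Q. In the others G^v0 = x^v0 Gam^v0 supplies the
   factor to cancel. *)
rewrite /H big_split_ord /= big1 ?add0r => [|n _]; last first.
  rewrite /Q psX_exp_mul leqNgt ltn_ord /= (_ : pscst 0 = 0) ?inx0 ?mul0r //.
  by apply/funext => z; rewrite /pscst if_same.
rewrite (eq_bigr (fun n : 'I_N => psX (ps K) ^+ v0 *
    (Gam ^+ v0 * (inx (pscst (q n)) * G ^+ n)))) => [|n _]; last first.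
  by rewrite /Q psX_exp_mul leq_addr addKn exprD {1}GE exprMn; ring.
rewrite -!big_distrr /= /Q inxM inxX inx_psX -mulrA -mulrBr psX_exp_mul.
by rewrite leq_addr addKn !psBE => /eqP; rewrite subr_eq0 => /eqP.
Qed.
End KeyIdentity.

(** * Substitution of nilpotent elements *)

(* This is the value of [a] at [s] only if [s ^+ N = 0]; the bound has to be
   the same for all series, hence the proof argument of [pseval], which makes
   it a ring morphism. *)
Definition pssum (R S : comNzRingType) N (io : R -> S) (s : S) (a : ps R) : S :=
  \sum_(n < N) io (a n) * s ^+ n.

Lemma pssumE (R S : comNzRingType) N (io : R -> S) (s : S) (a : ps R) :
  pssum N io s a = \sum_(n < N) io (a n) * s ^+ n.
Proof. by []. Qed.

Section Evaluation.
Variables (R S : comNzRingType) (N : nat) (io : {rmorphism R -> S}).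
Variables (s : S) (sN : s ^+ N = 0).

Lemma horner_nilpotent (p : {poly S}) : p.[s] = \sum_(n < N) p`_n * s ^+ n.
Proof.
rewrite -{1}(poly_take_drop N p) hornerD hornerM hornerXn sN mulr0 addr0.
rewrite (horner_coef_wide _ (size_take_poly N p)).
by apply: eq_bigr => n _; rewrite coef_take_poly ltn_ord.
Qed.

Definition ps_of_poly (p : {poly R}) : ps R := fun n => p`_n.

Definition pseval of s ^+ N = 0 := pssum N io s.

Local Notation ev := (pseval sN).

Lemma pseval_poly (p : {poly R}) : ev (ps_of_poly p) = (map_poly io p).[s].
Proof.
by rewrite horner_nilpotent; apply: eq_bigr => n _; rewrite coef_map.
Qed.

Lemma pseval_eq (a b : ps R) :
  (forall n, (n < N)%N -> a n = b n) -> ev a = ev b.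
Proof. by move=> ab; apply: eq_bigr => n _; rewrite ab. Qed.

Lemma psevalE (a : ps R) : ev a = (map_poly io (pstrunc N a)).[s].
Proof.
rewrite -pseval_poly; apply: pseval_eq => n ltnN.
by rewrite /ps_of_poly coef_poly ltnN.
Qed.

Lemma pseval_is_zmod_morphism : zmod_morphism ev.
Proof.
move=> a b; rewrite /pseval /pssum -sumrB; apply: eq_bigr => n _.
by rewrite psBE rmorphB mulrBl.
Qed.

(** Evaluation of polynomials is multiplicative, and the product of the truncations agrees with the
    product of the series below N, which is all that [s] sees. *)
Lemma pseval_is_monoid_morphism : monoid_morphism ev.
Proof.
split=> [|a b].
  rewrite (_ : 1 = ps_of_poly 1).
    by rewrite pseval_poly rmorph1 hornerE.
  by apply/funext => n; rewrite /ps_of_poly coef1.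
rewrite (psevalE a) (psevalE b) -hornerM -rmorphM /= -pseval_poly.
by apply: pseval_eq => n ltnN; rewrite /ps_of_poly coef_pstrunc_mul.
Qed.

HB.instance Definition _ :=
  GRing.isZmodMorphism.Build (ps R) S ev pseval_is_zmod_morphism.
HB.instance Definition _ :=
  GRing.isMonoidMorphism.Build (ps R) S ev pseval_is_monoid_morphism.

Lemma pseval_psX : ev (psX R) = s.
Proof.
rewrite (_ : psX R = ps_of_poly 'X) ?pseval_poly ?map_polyX ?hornerX //.
by apply/funext => n; rewrite /ps_of_poly coefX.
Qed.

Lemma pseval_cst c : ev (pscst c) = io c.
Proof.
rewrite (_ : pscst c = ps_of_poly c%:P) ?pseval_poly ?map_polyC ?hornerC //.
by apply/funext => n; rewrite /ps_of_poly coefC.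
Qed.

Lemma pseval_split a : ev a = io (a 0%N) + s * ev (psshift 1 a).
Proof.
rewrite -{1}pseval_psX -pseval_cst -rmorphM -rmorphD /=; congr (ev _).
apply/funext => -[|n]; first by rewrite psDE psX_mul0 addr0.
by rewrite psDE psX_mulS add0r.
Qed.

End Evaluation.

Section Evaluation2.
Variables (K S : comNzRingType) (N : nat) (io : {rmorphism K -> S}).
Variables (s t : S) (sN : s ^+ N = 0) (tN : t ^+ N = 0).

Definition bpseval : ps (ps K) -> S := pseval (pseval io tN) sN.

HB.instance Definition _ := GRing.RMorphism.on bpseval.

Lemma bpseval_cst a : bpseval (pscst a) = pseval io tN a.
Proof. exact: pseval_cst. Qed.

Lemma bpseval_inx a : bpseval (inx a) = pseval io sN a.
Proof. by apply: eq_bigr => n _; rewrite /inx /= pseval_cst. Qed.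

Lemma bpseval_eq (A B : ps (ps K)) :
  (forall u v, (u < N)%N -> A u v = B u v) -> bpseval A = bpseval B.
Proof.
by move=> AB; apply: pseval_eq => u ltuN; apply/funext => v; apply: AB.
Qed.

End Evaluation2.

(** * Truncated polynomial rings and their coefficient maps *)

Lemma truncated_ring (R : comNzRingType) (N : nat) : (0 < N)%N ->
  exists (S : comNzRingType) (io : {rmorphism R -> S}) (s : S)
         (coef : nat -> {additive S -> R}),
    s ^+ N = 0 /\
    forall k r u, (k < N)%N -> coef k (io r * s ^+ u) = r *+ (u == k).
Proof.
case: N => // N _; pose h : {poly R} := 'X^(N.+1).
(* The ring is R[X]/(X^N), and coefficients are read off the reduced representative. *)
pose io : {rmorphism R -> {poly %/ h}} := in_qpoly h \o polyC.
pose coef k (p : {poly %/ h}) : R := (p : {poly R})`_k.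
have coef_add k : zmod_morphism (coef k) by move=> p p'; rewrite /coef /= coefB.
pose ca k : {additive {poly %/ h} -> R} :=
  HB.pack (coef k) (GRing.isZmodMorphism.Build _ _ _ (coef_add k)).
have hE : mk_monic h = h by apply: mk_monic_Xn.
have sN : in_qpoly h 'X ^+ N.+1 = 0.
  rewrite -rmorphXn /=; apply/val_inj => /=.
  by rewrite hE Pdiv.RingMonic.rmodpp // monicXn.
exists {poly %/ h}, io, (in_qpoly h 'X), ca; split=> // k r u ltkN.
(* Beyond the truncation both sides vanish, as [k] lies below it. *)
case: (ltnP u N.+1) => [ltuN|leNu]; last first.
  rewrite -(subnK leNu) exprD sN !mulr0 raddf0 subnK //.
  by case: eqP leNu => [->|]; rewrite ?mulr0n // leqNgt ltkN.
rewrite -rmorphXn -[io r]/(in_qpoly h r%:P) -rmorphM /= /coef in_qpoly_small.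
  by rewrite coefCM coefXn eq_sym mulr_natr.
rewrite hE size_polyXn ltnS (leq_trans (size_polyMleq _ _)) //.
by rewrite size_polyXn size_polyC; case: (r != 0) => /=; rewrite ?add0n // ltnW.
Qed.

Lemma truncated_ring3 (K : comNzRingType) (N : nat) : (0 < N)%N ->
  exists (S : comNzRingType) (io : {rmorphism K -> S}) (x y z : S)
         (coef : nat -> nat -> nat -> {additive S -> K}),
    [/\ x ^+ N = 0, y ^+ N = 0, z ^+ N = 0 &
      forall i j k r u v w, (i < N)%N -> (j < N)%N -> (k < N)%N ->
        coef i j k (io r * x ^+ u * y ^+ v * z ^+ w)
        = r *+ [&& u == i, v == j & w == k]].
Proof.
move=> N_gt0.
have [S1 [io1 [x [c1 [xN c1E]]]]] := truncated_ring K N_gt0.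
have [S2 [io2 [y [c2 [yN c2E]]]]] := truncated_ring S1 N_gt0.
have [S3 [io3 [z [c3 [zN c3E]]]]] := truncated_ring S2 N_gt0.
exists S3, (io3 \o io2 \o io1), (io3 (io2 x)), (io3 y), z.
exists (fun i j k => c1 i \o c2 j \o c3 k); split=> //.
- by rewrite -!rmorphXn xN !rmorph0.
- by rewrite -!rmorphXn yN !rmorph0.
move=> i j k r u v w ltiN ltjN ltkN /=.
rewrite -!rmorphXn -!rmorphM c3E // raddfMn c2E // !raddfMn c1E //.
by rewrite -!mulrnA; congr (_ *+ _); case: eqP; case: eqP; case: eqP.
Qed.

(** * The identity in the truncated ring *)

Section Nilpotent.
Variable S : comNzRingType.
Implicit Types r s t u : S.

Definition nilpotent r := exists m, r ^+ m = 0.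

Lemma nilpotentM r s : nilpotent r -> nilpotent (r * s).
Proof. by case=> m rm; exists m; rewrite exprMn rm mul0r. Qed.

Lemma nilpotentD r s : nilpotent r -> nilpotent s -> nilpotent (r + s).
Proof.
move=> [m rm] [n sn]; exists (m + n)%N; rewrite exprDn big1 // => i _.
case: (leqP n i) => [/subnK <-|/ltnW lein].
  by rewrite exprD sn !mulr0 mul0rn.
by rewrite -addnBA // exprD rm !mul0r mul0rn.
Qed.

Definition nilcong r s := nilpotent (r - s).

Lemma nilcong_refl r : nilcong r r.
Proof. by exists 1%N; rewrite subrr expr1. Qed.

Lemma nilcongD r s t u :
  nilcong r s -> nilcong t u -> nilcong (r + t) (s + u).
Proof. by rewrite /nilcong opprD addrACA; apply: nilpotentD. Qed.

Lemma nilcongM r s t u :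
  nilcong r s -> nilcong t u -> nilcong (r * t) (s * u).
Proof.
move=> rs tu; rewrite /nilcong.
rewrite (_ : _ - _ = (r - s) * t + (t - u) * s); last by ring.
by apply: nilpotentD; apply: nilpotentM.
Qed.

Lemma nilcongX r s n : nilcong r s -> nilcong (r ^+ n) (s ^+ n).
Proof.
move=> rs; elim: n => [|n IH]; first exact: nilcong_refl.
by rewrite !exprS; apply: nilcongM.
Qed.

(** A unit plus a nilpotent is not a zero divisor: d u = 0 gives d = d n with n = -(u - c) c'
    nilpotent, and iterating gives d = 0. *)
Lemma nilcong_cancel (d u c c' : S) :
  c * c' = 1 -> nilcong u c -> d * u = 0 -> d = 0.
Proof.
move=> cc' /(nilpotentM (- c')) [m nm] du.
have dE : d = d * ((u - c) * - c').
  by rewrite mulrA mulrBr du sub0r mulrNN -mulrA cc' mulr1.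
suff -> : d = d * ((u - c) * - c') ^+ m by rewrite nm mulr0.
by elim: m {nm} => [|m IH]; rewrite ?mulr1 // exprS mulrA -dE.
Qed.

End Nilpotent.

Lemma pssum_sub (R S : comNzRingType) N (io : R -> S) (s t : S) (a : ps R) :
  exists r, pssum N io s a - pssum N io t a = (s - t) * r.
Proof.
exists (\sum_(n < N) io (a n) * \sum_(i < n) s ^+ (n.-1 - i) * t ^+ i).
rewrite -sumrB mulr_sumr; apply: eq_bigr => n _.
by rewrite -mulrBr subrXX mulrCA.
Qed.

Section CycleSet.
Variables (K : fieldType) (S : comNzRingType) (io : {rmorphism K -> S}).
Variables (N v0 : nat) (F q : ps K) (G Gam : ps (ps K)).
Hypothesis char0 : [pchar K] =i pred0.
Hypothesis v0_gt0 : (0 < v0)%N.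
Hypothesis q0 : q 0%N = - v0%:R.
Hypothesis Gam00 : Gam 0%N 0%N = 1.
Hypothesis GE : G = psX (ps K) * Gam.
Hypothesis qF : (1 + psX K ^+ v0 * q) * F = 1.
Hypothesis GamE : forall u v, (u < N)%N ->
  (Gam ^+ v0 * \sum_(n < N) inx (pscst (q n)) * G ^+ n) u v
  = (inx q * pscst F) u v.

Local Notation ev := (pssum N io).
Local Notation ev2 s t := (pssum N (pssum N io t) s).
Implicit Types s t : S.

Lemma ev2_G s t : s ^+ N = 0 -> t ^+ N = 0 -> ev2 s t G = s * ev2 s t Gam.
Proof.
move=> sN tN; rewrite -[LHS]/(bpseval io sN tN G) GE rmorphM /=; congr (_ * _).
exact: pseval_psX.
Qed.

(** The same bound N survives, so values of G can be substituted into series again. *)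
Lemma ev2_G_nil s t : s ^+ N = 0 -> t ^+ N = 0 -> ev2 s t G ^+ N = 0.
Proof. by move=> sN tN; rewrite ev2_G // exprMn sN mul0r. Qed.

Lemma ev_key s t : s ^+ N = 0 -> t ^+ N = 0 ->
  ev2 s t Gam ^+ v0 * ev (ev2 s t G) q = ev s q * ev t F.
Proof.
move=> sN tN.
have := bpseval_eq io sN tN GamE; rewrite !rmorphM rmorphXn rmorph_sum /=.
rewrite bpseval_inx bpseval_cst => <-; congr (_ * _); apply: eq_bigr => n _.
by rewrite rmorphM rmorphXn /= bpseval_inx pseval_cst.
Qed.

Lemma ev_qF s : s ^+ N = 0 -> (1 + s ^+ v0 * ev s q) * ev s F = 1.
Proof.
move=> sN; have := congr1 (pseval io sN) qF.
by rewrite rmorphM rmorphD rmorphM rmorphXn !rmorph1 /= pseval_psX.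
Qed.

Lemma ev_cong s (a : ps K) : s ^+ N = 0 -> nilcong (ev s a) (io (a 0%N)).
Proof.
move=> sN; rewrite /nilcong -[ev s a]/(pseval io sN a) pseval_split addrC addKr.
by apply: nilpotentM; exists N.
Qed.

Lemma ev2_Gam_cong s t : s ^+ N = 0 -> t ^+ N = 0 -> nilcong (ev2 s t Gam) 1.
Proof.
move=> sN tN; rewrite -[1](addr0) -[ev2 s t Gam]/(bpseval io sN tN Gam).
rewrite /bpseval pseval_split; apply: nilcongD.
  by rewrite -[1](rmorph1 io) -Gam00; apply: ev_cong.
by rewrite /nilcong subr0; apply: nilpotentM; exists N.
Qed.

(** With Q = x^v0 q, the closed form gives 1/F(G(s,t)) = 1 + Q(s) F(t). Multiplying by 1/F(t) = 1 +
    Q(t) yields 1 + Q(t) + Q(s), which is symmetric in s and t. *)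
Lemma ev_F_sym s t : s ^+ N = 0 -> t ^+ N = 0 ->
  ev t F * ev (ev2 s t G) F * (1 + t ^+ v0 * ev t q + s ^+ v0 * ev s q) = 1.
Proof.
move=> sN tN; have := ev_qF (ev2_G_nil sN tN).
rewrite {1}ev2_G // exprMn -[_ * _ * ev (ev2 s t G) q]mulrA ev_key // => bF.
have tF := ev_qF tN.
transitivity ((((1 + t ^+ v0 * ev t q) * ev t F) + s ^+ v0 * (ev s q * ev t F))
              * ev (ev2 s t G) F); first by ring.
by rewrite tF.
Qed.

(* u - u' divides the difference of the two sides, with a cofactor congruent
   to - v0^2 modulo nilpotent elements. *)
Lemma cycle_cancel s u u' : s ^+ N = 0 -> nilcong u 1 -> nilcong u' 1 ->
  u ^+ v0 * ev (s * u) q = u' ^+ v0 * ev (s * u') q -> u = u'.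
Proof.
move=> sN u1 u1' /eqP; rewrite -subr_eq0.
have [r rE] := pssum_sub N io (s * u) (s * u') q.
have -> : u ^+ v0 * ev (s * u) q - u' ^+ v0 * ev (s * u') q =
    (u - u') * ((\sum_(i < v0) u ^+ (v0.-1 - i) * u' ^+ i) * ev (s * u) q
               + s * (u' ^+ v0 * r)).
  rewrite mulrDr mulrA -subrXX.
  have -> : (u - u') * (s * (u' ^+ v0 * r)) =
      u' ^+ v0 * ((s * u - s * u') * r) by ring.
  by rewrite -rE; ring.
move/eqP => du; apply/eqP; rewrite -subr_eq0; apply/eqP.
have v0u : (v0%:R * - v0%:R : K) != 0.
  move/pcharf0P: char0 => nat_eq0.
  by rewrite mulf_eq0 oppr_eq0 nat_eq0 orbb -lt0n.
apply: (nilcong_cancel (c := io (v0%:R * - v0%:R))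
  (c' := io (v0%:R * - v0%:R)^-1)) du.
  by rewrite -rmorphM divff // rmorph1.
rewrite -[io _]addr0; apply: nilcongD; last first.
  by rewrite /nilcong subr0; apply: nilpotentM; exists N.
rewrite rmorphM; apply: nilcongM; last first.
  by rewrite -q0; apply: ev_cong; rewrite exprMn sN mul0r.
rewrite rmorph_nat -[v0 in v0%:R]card_ord -sumr_const.
apply: (big_ind2 (@nilcong S)) => [||i _]; first exact: nilcong_refl.
  exact: nilcongD.
rewrite -[1]mulr1; apply: nilcongM.
  by have := nilcongX (v0.-1 - i) u1; rewrite expr1n.
by have := nilcongX i u1'; rewrite expr1n.
Qed.

Lemma ev_cycle x y z : x ^+ N = 0 -> y ^+ N = 0 -> z ^+ N = 0 ->
  ev2 (ev2 x y G) (ev2 z y G) G = ev2 (ev2 x z G) (ev2 y z G) G.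
Proof.
move=> xN yN zN.
(* Each side of the goal is x times such a cofactor, and the cofactors themselves can be compared,
   being congruent to 1 modulo nilpotents. *)
pose U y z := ev2 x y Gam * ev2 (ev2 x y G) (ev2 z y G) Gam.
have HE s t : s ^+ N = 0 -> t ^+ N = 0 ->
    ev2 (ev2 x s G) (ev2 t s G) G = x * U s t.
  by move=> sN tN; rewrite ev2_G ?ev2_G_nil // {1}ev2_G // mulrA.
have Ucong s t : s ^+ N = 0 -> t ^+ N = 0 -> nilcong (U s t) 1.
  move=> sN tN; rewrite -[1]mulr1.
  by apply: nilcongM; apply: ev2_Gam_cong; rewrite ?ev2_G_nil.
(* The closed form is applied twice, to the outer and then to the inner G. *)
have UE s t : s ^+ N = 0 -> t ^+ N = 0 ->
    U s t ^+ v0 * ev (x * U s t) q = ev x q * (ev s F * ev (ev2 t s G) F).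
  move=> sN tN; rewrite -HE // exprMn -mulrA ev_key ?ev2_G_nil //.
  by rewrite !mulrA ev_key.
rewrite !HE //; congr (_ * _); apply: (cycle_cancel xN); try exact: Ucong.
rewrite !UE //; congr (_ * _).
(* The remaining factors are both inverse to 1 + Q(y) + Q(z). *)
have inv_eq (r s t : S) : r * t = 1 -> s * t = 1 -> r = s.
  by move=> rt st; rewrite -[r]mul1r -st -mulrA [t * r]mulrC rt mulr1.
by apply: inv_eq (ev_F_sym zN yN) _; rewrite addrAC; apply: ev_F_sym.
Qed.

End CycleSet.

Lemma sum_ord_shrink (T : nmodType) n m (F : nat -> T) : (n <= m)%N ->
  (forall p, (n <= p)%N -> F p = 0) -> \sum_(p < m) F p = \sum_(p < n) F p.
Proof.
move=> lenm F0; rewrite (big_ord_widen m F lenm) [RHS]big_mkcond.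
by apply: eq_bigr => p _; case: ltnP => // /F0.
Qed.

(** * Coefficients *)

Section CoefficientExtraction.
Variables (K S : comNzRingType) (io : {rmorphism K -> S}) (N i j k : nat).
Variables (x y z : S) (coef : {additive S -> K}) (G Gam : ps (ps K)).
Hypotheses (xN : x ^+ N = 0) (yN : y ^+ N = 0) (zN : z ^+ N = 0).
Hypotheses (ltiN : (i < N)%N) (ltjN : (j < N)%N) (ltkN : (k < N)%N).
Hypothesis coefE : forall r u v w,
  coef (io r * x ^+ u * y ^+ v * z ^+ w) = r *+ [&& u == i, v == j & w == k].
Hypothesis GE : G = psX (ps K) * Gam.

Local Notation ev2 s t := (pssum N (pssum N io t) s).

(** Only A involves x and only B involves z, so the exponents i and k select one row of each. The
    two rows multiply as series in y. *)
Lemma coef_ev2M r (A B : ps (ps K)) :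
  coef (io r * ev2 z y B * ev2 x y A) = r * (A i * B k) j.
Proof.
have -> : io r * ev2 z y B * ev2 x y A = \sum_(w < N) \sum_(u < N) \sum_(v < N)
    io (r * (A u * B w) v) * x ^+ u * y ^+ v * z ^+ w.
  rewrite [ev2 z y B]pssumE [io r * _]mulr_sumr mulr_suml.
  apply: eq_bigr => w _.
  rewrite [ev2 x y A]pssumE mulr_sumr; apply: eq_bigr => u _.
  have -> : io r * (pssum N io y (B w) * z ^+ w) * (pssum N io y (A u) * x ^+ u)
      = pseval io yN (A u * B w) * (io r * x ^+ u * z ^+ w).
    by rewrite rmorphM /= /pseval; ring.
  rewrite /pseval pssumE mulr_suml; apply: eq_bigr => v _.
  by rewrite rmorphM; ring.
rewrite raddf_sum (bigD1 (Ordinal ltkN)) //= [X in _ + X]big1 => [|w ne].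
  rewrite addr0 raddf_sum (bigD1 (Ordinal ltiN)) //=.
  rewrite [X in _ + X]big1 => [|u ne].
    rewrite addr0 raddf_sum (bigD1 (Ordinal ltjN)) //=.
    rewrite [X in _ + X]big1 => [|v ne].
      by rewrite addr0 coefE !eqxx.
    by rewrite coefE (negbTE (ne : val v != j)) andbF.
  rewrite raddf_sum big1 // => v _.
  by rewrite coefE (negbTE (ne : val u != i)).
rewrite raddf_sum big1 // => u _; rewrite raddf_sum big1 // => v _.
by rewrite coefE (negbTE (ne : val w != k)) !andbF.
Qed.

(** This is what bounds the sums by h <= i and l <= k. *)
Lemma exp_x_order h u : (u < h)%N -> (G ^+ h) u = 0.
Proof. by move=> ltuh; rewrite GE exprMn psX_exp_mul leqNgt ltuh. Qed.

Lemma coef_ev_cycle :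
  coef (ev2 (ev2 x y G) (ev2 z y G) G) =
  \sum_(a < j.+1) \sum_(h < i.+1) \sum_(l < k.+1)
    (G ^+ h) i a * (G ^+ l) k (j - a)%N * G h l.
Proof.
pose c h l := G h l * ((G ^+ h) i * (G ^+ l) k) j.
have evX s t h (sN : s ^+ N = 0) (tN : t ^+ N = 0) :
    ev2 s t G ^+ h = ev2 s t (G ^+ h).
  by rewrite -[ev2 s t G]/(bpseval io sN tN G) -rmorphXn.
have -> : coef (ev2 (ev2 x y G) (ev2 z y G) G) =
    \sum_(h < N) \sum_(l < N) c h l.
  rewrite pssumE raddf_sum; apply: eq_bigr => h _.
  rewrite pssumE mulr_suml raddf_sum; apply: eq_bigr => l _.
  by rewrite !evX // coef_ev2M.
rewrite (sum_ord_shrink (n := i.+1) (F := fun h => \sum_(l < N) c h l)) //;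
    last first.
  move=> h lth; rewrite big1 // => l _.
  by rewrite /c exp_x_order // mul0r mulr0.
rewrite [RHS]exchange_big; apply: eq_bigr => h _ /=.
rewrite (sum_ord_shrink (n := k.+1) (F := c h)) //; last first.
  by move=> l ltl; rewrite /c [(G ^+ l) k]exp_x_order // mulr0 mulr0.
rewrite [RHS]exchange_big; apply: eq_bigr => l _ /=.
by rewrite /c psME mulr_sumr; apply: eq_bigr => a _; rewrite mulrC.
Qed.

End CoefficientExtraction.

Theorem theorem3p2 (K : closedFieldType) (hK : [pchar K] =i pred0)
  (v0 : nat) (hv0 : (1 <= v0)%N)
  (f : ps K)
  (hf0 : f 0%N = 1)
  (hfgap : forall v, (0 < v < v0)%N -> f v = 0)
  (hfv0 : f v0 = 1)
  (g : ps K)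
  (hg : psmul g (psderiv f) = psmul f (pssub (psexp f v0) (psone K)))
  (G : bps K)
  (hG0 : forall u, G u 0%N = psX K u)
  (hGeq : bpsdy G =
          bpssub (bpsmul (bpsmul (xser g) (yser (psderiv f))) (bpsdx G))
                 (bpsmul (yser (pssub f (psone K))) (bpsdy G)))
  (i j k : nat) :
  \sum_(a < j.+1) \sum_(h < i.+1) \sum_(l < k.+1)
      frakp G h i a * frakp G l k (j - a)%N * frakp G 1 h l
  = \sum_(c < k.+1) \sum_(h < i.+1) \sum_(l < j.+1)
      frakp G h i c * frakp G l j (k - c)%N * frakp G 1 h l.
Proof.
have gE : (g : ps K) * psderiv f = (f : ps K) * ((f : ps K) ^+ v0 - 1).
  by rewrite -psexpE; exact: hg.
have G_pde : pdeop f g G = 0.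
  move: hGeq; rewrite !bpsmulE bpsdxE !yserE.
  rewrite -[bpsdy G]/(dery G) -[xser g]/(inx g).
  move=> e; rewrite /pdeop.
  have -> : pscst (f : ps K) = 1 + pscst (pssub f (psone K)).
    apply/funext => u; apply/funext => v; rewrite !psDE ps1E /pscst.
    by case: eqP => _; rewrite ?addr0 // /pssub addrC subrK.
  rewrite mulrDl mul1r {1}e; apply/eqP; rewrite subr_eq0.
  by apply/eqP; exact: subrK.
have [q [Gam [q0 Gam00 GE qF GamE]]] :=
  series_G_eq hK hv0 hf0 hfgap hfv0 gE hG0 G_pde.
pose N := (i + j + k).+1.
have [ltiN ltjN ltkN] : [/\ (i < N)%N, (j < N)%N & (k < N)%N].
  rewrite /N !ltnS; split; rewrite ?leq_addl // -addnA ?leq_addr //.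
  by rewrite addnCA leq_addr.
have [S [io [x [y [z [coef [xN yN zN coefE]]]]]]] :=
  truncated_ring3 K (ltn0Sn (i + j + k)).
have frak n u v : frakp G n u v = ((G : ps (ps K)) ^+ n) u v by rewrite frakpE.
have := ev_cycle io hK hv0 q0 Gam00 GE qF (GamE N) xN yN zN.
move/(congr1 (coef i j k)).
rewrite (coef_ev_cycle (i := i) (j := j) (k := k) xN yN zN _ _ _ _ GE) //;
  last by move=> r u v w; exact: coefE.
(* The other side is the same expansion with y and z, hence j and k, exchanged, for the same
   coefficient map. *)
rewrite (coef_ev_cycle (i := i) (j := k) (k := j) xN zN yN _ _ _ _ GE) //;
  last first.
  by move=> r u v w; rewrite mulrAC coefE // [(w == j) && _]andbC.
move=> E; have frak_sum m n :
    \sum_(a < m.+1) \sum_(h < i.+1) \sum_(l < n.+1)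
      frakp G h i a * frakp G l n (m - a)%N * frakp G 1 h l =
    \sum_(a < m.+1) \sum_(h < i.+1) \sum_(l < n.+1)
      ((G : ps (ps K)) ^+ h) i a * ((G : ps (ps K)) ^+ l) n (m - a)%N * G h l.
  by do 3![apply: eq_bigr => ? _]; rewrite !frak.
by rewrite !frak_sum.
Qed.
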